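(* Let $\mathbf{Y}$ be a finite non-empty set. In the double testing protocol described in the context, Sceptic has a strategy (a rule choosing his moves $f^{\mathrm{I}}_n,f^{\mathrm{II}}_n$ at each step $n$ as a function of all the other players' moves made before his move) which keeps both capitals non-negative, $\mathcal{K}^{\mathrm{I}}_n\ge 0$ and $\mathcal{K}^{\mathrm{II}}_n\ge 0$ for all $n$, and which guarantees that, whatever moves Forecaster I, Forecaster II and Reality make, at least one of the following three statements holds: \begin{itemize} \item $\|P^{\mathrm{I}}_n-P^{\mathrm{II}}_n\|\to 0$ as $n\to\infty$; \item $\mathcal{K}^{\mathrm{I}}_n\to\infty$ as $n\to\infty$; \item $\mathcal{K}^{\mathrm{II}}_n\to\infty$ as $n\to\infty$. \end{itemize}
   Context: $\mathbf{Y}$ is a finite non-empty set (the observation space) with the discrete $\sigma$-algebra. $\mathbf{Y}^*$ is the set of all finite sequences of elements of $\mathbf{Y}$ (including the empty one), $\mathbf{Y}^+$ is the set of all non-empty finite sequences, and for $x\in\mathbf{Y}^*$, $[x]\subseteq\mathbf{Y}^\infty$ is the set of all infinite sequences having $x$ as a prefix (so $[x]=\mathbf{Y}^\infty$ for the empty $x$). For $y\in\mathbf{Y}$ and $x\in\mathbf{Y}^*$, $yx\in\mathbf{Y}^+$ is the sequence $y$ followed by $x$. $\mathfrak{P}(\mathbf{Y}^\infty)$ is the set of all probability measures on $\mathbf{Y}^\infty$ with its Borel $\sigma$-algebra (product topology). For $P,Q\in\mathfrak{P}(\mathbf{Y}^\infty)$, the total variation distance is $\|P-Q\|:=2\sup_E|P(E)-Q(E)|\in[0,2]$,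 with $E$ ranging over Borel subsets of $\mathbf{Y}^\infty$. Double testing protocol (a perfect-information game; the players move in the stated order and see all previous moves). Start with $\mathcal{K}^{\mathrm{I}}_0=\mathcal{K}^{\mathrm{II}}_0:=1$. For $n=1,2,\dots$: \begin{enumerate} \item Forecaster I announces $P^{\mathrm{I}}_n\in\mathfrak{P}(\mathbf{Y}^\infty)$. \item Forecaster II announces $P^{\mathrm{II}}_n\in\mathfrak{P}(\mathbf{Y}^\infty)$. \item If $n>1$, the capitals are updated by $$\mathcal{K}^{\mathrm{I}}_{n-1}:=\mathcal{K}^{\mathrm{I}}_{n-2}+\sum_{x\in\mathbf{Y}^*}f^{\mathrm{I}}_{n-1}(y_{n-1}x)\,P^{\mathrm{I}}_n([x])-\sum_{x\in\mathbf{Y}^+}f^{\mathrm{I}}_{n-1}(x)\,P^{\mathrm{I}}_{n-1}([x]),$$ $$\mathcal{K}^{\mathrm{II}}_{n-1}:=\mathcal{K}^{\mathrm{II}}_{n-2}+\sum_{x\in\mathbf{Y}^*}f^{\mathrm{II}}_{n-1}(y_{n-1}x)\,P^{\mathrm{II}}_n([x])-\sum_{x\in\mathbf{Y}^+}f^{\mathrm{II}}_{n-1}(x)\,P^{\mathrm{II}}_{n-1}([x]).$$ \item Sceptic announces functions $f^{\mathrm{I}}_n,f^{\mathrm{II}}_n:\mathbf{Y}^+\to\mathbb{R}$ such that $f^{\mathrm{I}}_n(x)=f^{\mathrm{II}}_n(x)=0$ for all but finitely many $x\in\mathbf{Y}^+$. \item Reality announces $y_n\in\mathbf{Y}$. \end{enumerate}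 Here $P^{\mathrm{I}}_n$ and $P^{\mathrm{II}}_n$ are forecasts for the future sequence $(y_n,y_{n+1},\dots)$. No relation is assumed between the forecasts at different steps. Sceptic is never allowed to go into debt: if a capital becomes negative, his attempt fails. *)

(* Defs.v *)
From HB Require Import structures.
From mathcomp Require Import all_boot all_order all_algebra finmap.
From mathcomp Require Import all_classical all_reals all_analysis.
Set Implicit Arguments.
Unset Strict Implicit.
Unset Printing Implicit Defensive.
Import Order.TTheory GRing.Theory Num.Theory.
Import numFieldNormedType.Exports.
Local Open Scope classical_set_scope.
Local Open Scope ring_scope.

(* The argument [hY] is only there because measurable types have to be pointed:
   it supplies a default sequence. *)
Definition obs_seq (Y : finType) (hY : (0 < #|Y|)%N) : Type :=
  prod_topology (fun _ : nat => discrete_topology Y).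

HB.instance Definition _ (Y : finType) (hY : (0 < #|Y|)%N) :=
  Topological.on (obs_seq hY).
HB.instance Definition _ (Y : finType) (hY : (0 < #|Y|)%N) :=
  isPointed.Build (obs_seq hY) (fun=> enum_val (Ordinal hY)).

Definition borel_seq (Y : finType) (hY : (0 < #|Y|)%N) :=
  g_sigma_algebraType (@open (obs_seq hY)).

Definition forecast (R : realType) (Y : finType) (hY : (0 < #|Y|)%N) : Type :=
  probability (borel_seq hY) R.

Definition cylinder (Y : finType) (hY : (0 < #|Y|)%N) (x : seq Y) :
    set (borel_seq hY) :=
  [set w | mkseq w (size x) = x].
Arguments cylinder {Y} hY x.

Definition tv_dist (R : realType) (Y : finType) (hY : (0 < #|Y|)%N)
    (P Q : forecast R hY) : R :=
  2 * sup [set `|fine (P E) - fine (Q E)| |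
            E in (measurable : set (set (borel_seq hY)))].

Notation nonempty_seq Y := {x : seq Y | x != [::]}.

Definition necons (Y : finType) (y : Y) (x : seq Y) : nonempty_seq Y :=
  exist _ (y :: x) isT.

Definition ticket (R : realType) (Y : finType) : Type :=
  {fsfun nonempty_seq Y -> R with 0}.

(* Rounds are numbered from 0: [P n], [f n] and [y n] are the moves
   P_(n+1), f_(n+1) and y_(n+1) of step n+1, whereas [capital P f y n] is the
   capital K_n, which involves the forecasts P_1, ..., P_(n+1).
   The sums are finite because tickets have finite support. *)
Fixpoint capital (R : realType) (Y : finType) (hY : (0 < #|Y|)%N)
    (P : nat -> forecast R hY) (f : nat -> ticket R Y) (y : nat -> Y)
    (n : nat) : R :=
  if n is m.+1 then
    capital P f y m
    + \sum_(x \in [set: seq Y])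
        f m (necons (y m) x) * fine (P m.+1 (cylinder hY x))
    - \sum_(x \in [set: nonempty_seq Y])
        f m x * fine (P m (cylinder hY (val x)))
  else 1.

(* A rule producing the pair of tickets from the list of completed rounds
   (oldest first) and the two forecasts just announced. *)
Definition strategy (R : realType) (Y : finType) (hY : (0 < #|Y|)%N) : Type :=
  seq (forecast R hY * forecast R hY * Y) ->
  forecast R hY -> forecast R hY -> ticket R Y * ticket R Y.

Definition sceptic_move (R : realType) (Y : finType) (hY : (0 < #|Y|)%N)
    (S : strategy R hY) (PI PII : nat -> forecast R hY) (y : nat -> Y)
    (n : nat) : ticket R Y * ticket R Y :=
  S (mkseq (fun k => (PI k, PII k, y k)) n) (PI n) (PII n).

Definition capital_I (R : realType) (Y : finType) (hY : (0 < #|Y|)%N)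
    (S : strategy R hY) (PI PII : nat -> forecast R hY) (y : nat -> Y) :
    nat -> R :=
  capital PI (fun n => (sceptic_move S PI PII y n).1) y.

Definition capital_II (R : realType) (Y : finType) (hY : (0 < #|Y|)%N)
    (S : strategy R hY) (PI PII : nat -> forecast R hY) (y : nat -> Y) :
    nat -> R :=
  capital PII (fun n => (sceptic_move S PI PII y n).2) y.

(* Main.v *)
(* Fix d > 0 and suppose that some event E depending on the next n observations
   only has p - q >= d, where p and q are its probabilities under P^I and P^II.
   With u = d / 2, Sceptic buys 1 - u (1_E - p) against Forecaster I and
   1 + u (1_E - q) against Forecaster II, both at price 1, and holds them for n
   rounds, whatever the intermediate prices are.  The product of the two payoffs
   is at least 1 + d^2 / 4.  If such events occur infinitely often, repeating
   this makes the product of the two capitals unbounded at the times when no bet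
   is pending; hence if one unit is set aside each time that a capital reaches 2
   at such a time, the savings against one of the forecasters tend to infinity.
   A countable mixture over the thresholds d = 1 / (j + 1) covers all cases,
   because by the monotone class theorem the total variation distance is
   determined by the events that depend on finitely many observations. *)

Require Import Defs.
From mathcomp Require Import all_boot all_order all_algebra.
From mathcomp Require Import finmap ring lra zify.
From mathcomp Require Import all_classical all_reals all_analysis.
Set Implicit Arguments.
Unset Strict Implicit.
Unset Printing Implicit Defensive.
Import Order.TTheory GRing.Theory Num.Theory.
Import numFieldNormedType.Exports.
Local Open Scope classical_set_scope.
Local Open Scope ring_scope.

(** * Events depending on finitely many observations *)

Section CylinderEvents.
Variables (R : realType) (Y : finType) (hY : (0 < #|Y|)%N).
Implicit Types (P Q : forecast R hY) (x : seq Y) (e : pred (seq Y)) (n : nat).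

Definition cylinder_event n e : set (borel_seq hY) :=
  [set w | e (mkseq w n)].

Lemma open_cylinder x : open (cylinder hY x : set (obs_seq hY)).
Proof.
elim/last_ind: x => [|x y IH].
  rewrite (_ : cylinder hY [::] = setT); first exact: openT.
  by apply/seteqP; split.
rewrite (_ : cylinder hY _ = cylinder hY x `&`
    (proj (size x) : obs_seq hY -> discrete_topology Y) @^-1` [set y]);
    last first.
  apply/seteqP; split => w; rewrite /cylinder /= size_rcons mkseqS.
    by move=> /eqP; rewrite eqseq_rcons => /andP[/eqP ? /eqP].
  by case=> -> <-.
apply: openI => //; apply: open_comp; last exact: discrete_open.
by move=> w _; exact: proj_continuous.
Qed.

Lemma cylinder_mkseqP (v w : borel_seq hY) n :
  cylinder hY (mkseq w n) v <-> mkseq v n = mkseq w n.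
Proof. by rewrite -{2}(size_mkseq w n). Qed.

Lemma measurable_cylinder x : measurable (cylinder hY x).
Proof. by apply: sub_sigma_algebra; exact: open_cylinder. Qed.

(** In the product of discrete topologies the cylinders along [w] converge to [w], so one of them
    already lies inside any open set containing [w]. *)
Lemma open_bigcup_cylinder_event (U : set (obs_seq hY)) : open U ->
  U = \bigcup_n cylinder_event n (fun x => `[< cylinder hY x `<=` U >]).
Proof.
move=> oU; apply/seteqP; split => [w Uw|w [n _ /asboolP]]; last first.
  by apply; exact/cylinder_mkseqP.
pose F := filter_from [set: nat] (fun n => cylinder hY (mkseq w n)).
have FF : Filter F.
  apply: filter_from_filter; first by exists 0%N.
  move=> i j _ _; exists (maxn i j) => // v /cylinder_mkseqP vw.
  have wv k : (k <= maxn i j)%N -> mkseq v k = mkseq w k.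
    move=> km; have /(congr1 (take k)) := vw.
    by rewrite /mkseq -!map_take take_iota (minn_idPl km).
  by split; apply/cylinder_mkseqP; apply: wv; rewrite ?leq_maxl ?leq_maxr.
have : F --> (w : obs_seq hY).
  have := @pointwise_cvgP nat (discrete_topology Y) F w FF.
  move=> [_]; apply => k; apply/discrete_cvg.
  exists k.+1 => // v /cylinder_mkseqP vw.
  by have := congr1 (nth (w k) ^~ k) vw; rewrite !nth_mkseq.
move=> /(_ U) []; first by apply: open_nbhs_nbhs.
by move=> n _ nU; exists n => //; exact/asboolP.
Qed.

Lemma measurable_cylinder_event n e : measurable (cylinder_event n e).
Proof.
rewrite (_ : cylinder_event n e =
    \bigcup_(x in [set x | (size x == n) && e x]) cylinder hY x).
  by apply: sub_sigma_algebra; apply: bigcup_open => x _; exact: open_cylinder.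
apply/seteqP; split => [w ew|w [x /= /andP[/eqP <- ex]]].
  by exists (mkseq w n); [rewrite /= size_mkseq eqxx|exact/cylinder_mkseqP].
by rewrite /cylinder /cylinder_event /= => ->.
Qed.

Lemma cylinder_event_take n m e : (n <= m)%N ->
  cylinder_event n e = cylinder_event m (fun x => e (take n x)).
Proof.
move=> nm; apply/funext => w; rewrite /cylinder_event /=.
by rewrite -map_take take_iota (minn_idPl nm).
Qed.

Lemma setring_cylinder_event :
  setring [set A | exists n e, A = cylinder_event n e].
Proof.
split.
- by exists 0%N, pred0; apply/seteqP; split.
- move=> _ _ [n [e ->]] [m [e' ->]].
  exists (maxn n m), (fun x => e (take n x) || e' (take m x)).
  rewrite (cylinder_event_take e (leq_maxl n m)).
  rewrite (cylinder_event_take e' (leq_maxr n m)).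
  by apply/seteqP; split => w /= /orP.
- move=> _ _ [n [e ->]] [m [e' ->]].
  exists (maxn n m), (fun x => e (take n x) && ~~ e' (take m x)).
  rewrite (cylinder_event_take e (leq_maxl n m)).
  rewrite (cylinder_event_take e' (leq_maxr n m)).
  apply/seteqP; split => [w /= [ew /negP e'w]|w /= /andP[ew /negP e'w]] //.
  by apply/andP.
Qed.

(** The sigma-ring contains the whole space, as the event of [predT], hence is closed under
    complements; each open set is a countable union of its members. The ring form is the one that
    the monotone class theorem below takes. *)
Lemma measurable_sub_cylinder_event : (measurable : set (set (borel_seq hY)))
  `<=` <<sr [set A | exists n e, A = cylinder_event n e]>>.
Proof.
have [sr0 srD srU] := smallest_sigma_ring
  [set A : set (borel_seq hY) | exists n e, A = cylinder_event n e].
apply: smallest_sub => [|U oU].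
  split => // A sA; apply: srD => //; apply: sub_g_sigma_ring.
  by exists 0%N, predT; apply/seteqP; split.
rewrite (open_bigcup_cylinder_event oU); apply: srU => n.
by apply: sub_g_sigma_ring; exists n, (fun x => `[< cylinder hY x `<=` U >]).
Qed.

Lemma measurable_cylinder_event_ind (G : set (set (borel_seq hY))) :
  monotone G -> (forall n e, G (cylinder_event n e)) ->
  forall A, measurable A -> G A.
Proof.
move=> mG Ge A /measurable_sub_cylinder_event; move: A.
apply: monotone_setring_sub_g_sigma_ring => //.
  exact: setring_cylinder_event.
by move=> _ [n [e ->]].
Qed.

(** Probabilities are continuous along monotone sequences and the bound passes to limits, so the
    sets satisfying it form a monotone class. *)
Lemma forecast_le_cylinder_event P Q (d : R) :
    (forall n e,
      `|fine (P (cylinder_event n e)) - fine (Q (cylinder_event n e))| <= d) ->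
  forall A, measurable A -> `|fine (P A) - fine (Q A)| <= d.
Proof.
(* Measurability is made part of the class because continuity along [F] requires it. *)
move=> Pd A mA; suff [] : measurable A /\ `|fine (P A) - fine (Q A)| <= d by [].
move: A mA; apply: measurable_cylinder_event_ind; last first.
  by move=> n e; split => //; exact: measurable_cylinder_event.
have fcvg (S : forecast R hY) (F : (set (borel_seq hY))^nat) A : measurable A ->
    S \o F @ \oo --> S A -> fine (S (F k)) @[k --> \oo] --> fine (S A).
  move=> mA h; apply: (fine_cvg (f := S \o F)).
  by rewrite fineK// fin_num_measure.
have lim_le F A : measurable A ->
    (forall k, `|fine (P (F k)) - fine (Q (F k))| <= d) ->
    P \o F @ \oo --> P A -> Q \o F @ \oo --> Q A ->
    `|fine (P A) - fine (Q A)| <= d.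
  move=> mA Fd /(fcvg _ _ _ mA) PF /(fcvg _ _ _ mA) QF.
  by apply: (cvgr_to_le (cvg_norm (cvgB PF QF))); apply: nearW.
split => F mF GF; have mFk k : measurable (F k) by have [] := GF k.
- have mU : measurable (\bigcup_k F k) by exact: bigcup_measurable.
  split => //; apply: (lim_le F) => //; first by move=> k; have [] := GF k.
    exact: nondecreasing_cvg_mu.
  exact: nondecreasing_cvg_mu.
- have mI : measurable (\bigcap_k F k) by exact: bigcap_measurable.
  split => //; apply: (lim_le F) => //; first by move=> k; have [] := GF k.
    by apply: nonincreasing_cvg_mu; rewrite ?ltey_eq ?fin_num_measure.
  by apply: nonincreasing_cvg_mu; rewrite ?ltey_eq ?fin_num_measure.
Qed.

Lemma fine_forecast_itv P A : measurable A -> 0 <= fine (P A) <= 1.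
Proof.
move=> mA; rewrite fine_ge0//= -lee_fin fineK ?fin_num_measure//.
exact: probability_le1.
Qed.

Lemma tv_dist_ge0 P Q : 0 <= tv_dist P Q.
Proof.
apply: mulr_ge0 => //.
apply: le_trans (normr_ge0 (fine (P set0) - fine (Q set0))) _.
apply: ub_le_sup; last by exists set0.
exists 1 => _ [A mA <-].
have := fine_forecast_itv P mA; have := fine_forecast_itv Q mA.
by rewrite ler_norml; lra.
Qed.

(** Passing to the complement flips the sign of the difference, so a one-sided bound over all events
    suffices. *)
Lemma tv_dist_le P Q (d : R) :
    (forall n e,
      fine (P (cylinder_event n e)) - fine (Q (cylinder_event n e)) <= d) ->
  tv_dist P Q <= 2 * d.
Proof.
move=> PQd; rewrite ler_pM2l//; apply: ge_sup.
  by exists `|fine (P set0) - fine (Q set0)|, set0.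
move=> _ [A mA <-]; apply: forecast_le_cylinder_event => // n e.
rewrite ler_norml PQd andbT lerNl opprB.
have := PQd n (predC e).
have -> : cylinder_event n (predC e) = ~` cylinder_event n e.
  by apply/seteqP; split => w /= /negP.
have me := measurable_cylinder_event n e.
rewrite !probability_setC// !fineB ?fin_num_measure//=.
lra.
Qed.
End CylinderEvents.
Arguments cylinder_event {Y} hY n e.

(** * Prices of tickets *)

Section Prices.
Variables (R : realType) (Y : finType) (hY : (0 < #|Y|)%N).
Implicit Types (P Q : forecast R hY) (x : seq Y) (n : nat) (g : seq Y -> R).

Fixpoint words n : seq (seq Y) :=
  if n is m.+1 then [seq y :: x | y <- enum Y, x <- words m] else [:: [::]].

Lemma mem_words n x : (x \in words n) = (size x == n).
Proof.
elim: n x => [|n IH] [|y x] //=.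
  by apply/allpairsP => -[[? ?] []].
rewrite eqSS -IH; apply/allpairsP/idP => [[[z v] /= [_ vn [_ ->]]]|xn] //.
by exists (y, x); rewrite mem_enum.
Qed.

Lemma words_uniq n : uniq (words n).
Proof.
elim: n => //= n IH; apply: allpairs_uniq => //; first exact: enum_uniq.
by move=> [? ?] [? ?] _ _ /= [-> ->].
Qed.

(** The expectation under [P] of [g] at the first [n] observations. *)
Definition price P n g : R :=
  \sum_(x <- words n) g x * fine (P (cylinder hY x)).

Lemma price_event P n (e : pred (seq Y)) :
  price P n (fun x => (e x)%:R) = fine (P (cylinder_event hY n e)).
Proof.
pose A := [seq x <- words n | e x].
have -> : cylinder_event hY n e = \bigcup_(x in [set` A]) cylinder hY x.
  apply/seteqP; split => [w ew|w [x]].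
    exists (mkseq w n); last exact/cylinder_mkseqP.
    by rewrite /= mem_filter mem_words size_mkseq eqxx andbT.
  rewrite /= mem_filter mem_words => /andP[ex /eqP xn].
  by rewrite /cylinder /cylinder_event /= xn => ->.
rewrite measure_fin_bigcup; first last.
- by move=> x _; exact: measurable_cylinder.
- move=> x z /=; rewrite !mem_filter !mem_words.
  move=> /andP[_ /eqP xn] /andP[_ /eqP zn].
  by case=> w []; rewrite /cylinder /= xn zn => <- <-.
- exact: finite_seq.
rewrite -fsbig_seq ?filter_uniq ?words_uniq// big_filter.
rewrite -sum_fine; last first.
  by move=> x _; apply: fin_num_measure; exact: measurable_cylinder.
rewrite /price [RHS]big_mkcond; apply: eq_bigr => x _.
by case: (e x); rewrite ?mul1r ?mul0r.
Qed.

Lemma priceD P n g g' :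
  price P n (fun x => g x + g' x) = price P n g + price P n g'.
Proof. by rewrite -big_split; apply: eq_bigr => x _; rewrite mulrDl. Qed.

Lemma priceZ P n (c : R) g : price P n (fun x => c * g x) = c * price P n g.
Proof. by rewrite mulr_sumr; apply: eq_bigr => x _; rewrite mulrA. Qed.

Lemma price_cst P n (c : R) : price P n (fun=> c) = c.
Proof.
transitivity (price P n (fun x => c * (predT x)%:R)).
  by apply: eq_bigr => x _; rewrite mulr1.
rewrite priceZ price_event (_ : cylinder_event _ _ _ = setT).
  by rewrite probability_setT mulr1.
by apply/seteqP; split.
Qed.

Lemma price0 P g : price P 0 g = g [::].
Proof.
rewrite -[RHS](price_cst P 0).
by apply: eq_big_seq => x; rewrite inE => /eqP ->.
Qed.

Lemma price_ge0 P n g : (forall x, 0 <= g x) -> 0 <= price P n g.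
Proof.
move=> g0; apply: sumr_ge0 => x _; apply: mulr_ge0 => //.
by have /andP[] := fine_forecast_itv P (measurable_cylinder (hY:=hY) x).
Qed.

Definition at_size n g : seq Y -> R := fun x => if size x == n then g x else 0.

Lemma at_size_support k (n : 'I_k -> nat) (g : 'I_k -> seq Y -> R) :
  exists A : {fset seq Y}, forall x j, x \notin A -> at_size (n j) (g j) x = 0.
Proof.
exists (\bigcup_(j <- enum 'I_k) [fset x in words (n j)])%fset => x j.
rewrite /at_size; case: eqP => // xn /bigfcupP[]; exists j.
  by rewrite mem_enum.
by rewrite !inE/= mem_words xn.
Qed.

Lemma fsbig_at_size k (n : 'I_k -> nat) (g : 'I_k -> seq Y -> R) :
  \sum_(x \in [set: seq Y]) \sum_(j < k) at_size (n j) (g j) x =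
  \sum_(j < k) \sum_(x <- words (n j)) g j x.
Proof.
have [A out] := at_size_support n g.
rewrite (fsbigTE A) => [|x xA]; last by rewrite big1 // => j _; exact: out.
rewrite exchange_big; apply: eq_bigr => j _ /=.
rewrite -(fsbigTE A) => [|x xA]; last exact: out.
rewrite [RHS]fsbig_seq ?words_uniq// [RHS]fsbig_mkcond; apply: eq_fsbigr => x _.
by rewrite /at_size /patch mem_setE mem_words.
Qed.

(** [fset_set] is meaningful on finite sets only; [ticket_ofE] checks the finiteness for sums of
    [at_size]. *)
Definition ticket_of g : ticket R Y :=
  [fsfun x in fset_set [set x : nonempty_seq Y | g (val x) != 0] => g (val x)].

Lemma ticket_ofE k (n : 'I_k -> nat) (g : 'I_k -> seq Y -> R)
    (x : nonempty_seq Y) :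
  ticket_of (fun x => \sum_(j < k) at_size (n j) (g j) x) x =
  \sum_(j < k) at_size (n j) (g j) (val x).
Proof.
have [A out] := at_size_support n g.
rewrite fsfunE in_fset_set.
  by rewrite mem_setE /=; case: ifPn => // /negPn/eqP ->.
apply: (@sub_finite_set _ _ (val @^-1` [set` A])).
  move=> z /=; apply: contra_neqT => zA.
  by rewrite big1 // => j _; exact: out.
apply: finite_preimage; first by move=> ? ? _ _; exact: val_inj.
exact: (finite_subfset A).
Qed.

(** Observing [y] turns a contract of horizon [m.+1] into one of horizon [m]. Horizon [0]
    contributes nothing, as tickets live on non-empty sequences. *)
Lemma sum_ticket_cons P k (n : 'I_k -> nat) (g : 'I_k -> seq Y -> R) (y : Y) :
  \sum_(x \in [set: seq Y])
    ticket_of (fun x => \sum_(j < k) at_size (n j) (g j) x) (necons y x)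
      * fine (P (cylinder hY x)) =
  \sum_(j < k) if n j is m.+1 then price P m (g j \o cons y) else 0.
Proof.
(* The predecessor sends horizons [0] and [1] both to [0]; the inner case distinction makes the
   former vanish. *)
transitivity (\sum_(x \in [set: seq Y]) \sum_(j < k) at_size (n j).-1
   (fun x => if n j is m.+1 then g j (y :: x) * fine (P (cylinder hY x)) else 0)
   x).
  apply: eq_fsbigr => x _; rewrite ticket_ofE mulr_suml; apply: eq_bigr => j _.
  rewrite /at_size /=; case: (n j) => [|m] /=; first by rewrite mul0r if_same.
  by rewrite eqSS; case: eqP => //; rewrite mul0r.
rewrite fsbig_at_size; apply: eq_bigr => j _.
by case: (n j) => //=; rewrite big1.
Qed.

Lemma sum_ticket P k (n : 'I_k -> nat) (g : 'I_k -> seq Y -> R) :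
  \sum_(x \in [set: nonempty_seq Y])
    ticket_of (fun x => \sum_(j < k) at_size (n j) (g j) x) x
      * fine (P (cylinder hY (val x))) =
  \sum_(j < k) if n j is m.+1 then price P m.+1 (g j) else 0.
Proof.
transitivity (\sum_(x \in [set: seq Y]) \sum_(j < k) at_size (n j)
   (fun x => if n j is m.+1 then g j x * fine (P (cylinder hY x)) else 0) x).
  (* The empty word may join the index set: its term is zero by the case distinction for horizon [0]
     and by [at_size] for the others. *)
  transitivity (\sum_(x \in [set x : seq Y | x != [::]])
   \sum_(j < k) at_size (n j)
   (fun x => if n j is m.+1 then g j x * fine (P (cylinder hY x)) else 0) x).
    rewrite (@reindex_fsbig _ _ _ _ _ (val : nonempty_seq Y -> seq Y) setT).
      apply: eq_fsbigr => x _; rewrite ticket_ofE mulr_suml.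
      apply: eq_bigr => j _; case: x => -[//|z x] /= _.
      rewrite /at_size /=; case: (n j) => [|m] /=; first by rewrite mul0r.
      by rewrite eqSS; case: eqP => //; rewrite mul0r.
    split => [[x]//|? ? _ _|x x0]; first exact: val_inj.
    by exists (exist _ x x0).
  rewrite fsbig_mkcond; apply: eq_fsbigr => x _.
  rewrite /patch mem_setE /=; case: ifPn => // /negPn/eqP ->.
  rewrite big1 // => j _; rewrite /at_size /=; by case: (n j).
rewrite fsbig_at_size; apply: eq_bigr => j _.
by case: (n j) => //=; rewrite big1.
Qed.
End Prices.

(** * Betting at a single level of disagreement *)

Section Positions.
Variables (R : realType) (Y : finType) (hY : (0 < #|Y|)%N).
Implicit Types (P Q : bool -> forecast R hY) (x : seq Y) (n : nat)
  (e : pred (seq Y)) (d : R) (y : Y) (b : bool).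

(* A position pays [asset b x] against forecaster [b] ([true] is Forecaster I)
   once the next [horizon] observations have turned out to be [x]; assets other
   than those of length [horizon] are irrelevant. *)
Record position := Position {
  horizon : nat;
  asset : bool -> seq Y -> R;
  saved : bool -> nat }.
Implicit Types s : position.

Definition worth P b s : R :=
  (saved s b)%:R + price (P b) (horizon s) (asset s b).

Definition start := Position 0 (fun _ _ => 1) (fun=> 0%N).

Definition gap P n e : R :=
  fine (P true (cylinder_event hY n e)) -
  fine (P false (cylinder_event hY n e)).

(* The stake [d / 2] maximises the lower bound [1 + u d - u ^+ 2] on the product
   of the two bets with stake [u]; see [bet_mul_ge]. *)
Definition bet d P n e b x : R :=
  1 + (-1) ^+ b * (d / 2) * ((e x)%:R - fine (P b (cylinder_event hY n e))).

(* Setting money aside turns an unbounded capital into one tending to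
   infinity. *)
Definition save s := Position 0
  (fun b _ => asset s b [::] - (2 <= asset s b [::])%R%:R)
  (fun b => saved s b + (2 <= asset s b [::])%R)%N.

(** Acts only when no bet is pending, so that the asset at [[::]] is plain cash; the event to bet on
    is picked by choice. *)
Definition rebalance d P s :=
  if horizon s is 0 then
    if pselect (exists ne, d <= gap P ne.1 ne.2) is left dP then
      let: (n, e) := projT1 (cid dP) in
      Position n (fun b x => asset (save s) b [::] * bet d P n e b x)
        (saved (save s))
    else save s
  else s.

Definition shift y s :=
  if horizon s is m.+1 then
    Position m (fun b x => asset s b (y :: x)) (saved s)
  else s.

Lemma worth_start P b : worth P b start = 1.
Proof. by rewrite /worth price_cst add0r. Qed.

Lemma worth_save P b s : horizon s = 0%N -> worth P b (save s) = worth P b s.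
Proof. by rewrite /worth => -> /=; rewrite !price0 natrD; ring. Qed.

Lemma price_bet d P n e b : price (P b) n (bet d P n e b) = 1.
Proof.
rewrite /bet priceD price_cst priceZ priceD price_cst price_event.
by rewrite subrr mulr0 addr0.
Qed.

(** Saving only relabels money, and each unit of cash buys a [bet] whose price is exactly 1. *)
Lemma worth_rebalance d P b s : worth P b (rebalance d P s) = worth P b s.
Proof.
rewrite /rebalance; case hs : (horizon s) => [|//].
case: pselect => [dP|_]; last exact: worth_save.
case: (projT1 _) => n e; rewrite -(worth_save P b hs) /worth /=.
by rewrite priceZ price_bet mulr1 price0.
Qed.

(** The right-hand side is the contribution of the position to the two ticket sums in [capital]. At
    horizon [0] it is cash, which no forecast revalues. *)
Lemma worth_shift P Q b y s : worth Q b (shift y s) - worth P b s =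
  (if horizon s is m.+1 then price (Q b) m (asset s b \o cons y) else 0)
  - (if horizon s is m.+1 then price (P b) m.+1 (asset s b) else 0).
Proof.
rewrite /worth /shift; case hs : (horizon s) => [|m] /=.
  by rewrite hs !price0; ring.
by rewrite /comp; ring.
Qed.

(** * Solvency and the product of the two payoffs *)

Definition solvent s := forall b x, 0 < asset s b x.

(** The stake is at most one half, and an indicator differs from its probability by at most 1. *)
Lemma bet_gt0 d P n e b x : 0 < d <= 1 -> 0 < bet d P n e b x.
Proof.
move=> d01; rewrite /bet.
have := fine_forecast_itv (P b) (measurable_cylinder_event (hY:=hY) n e).
by case: b; case: (e x) => /=; rewrite ?expr0 ?expr1; nra.
Qed.

(** With [u = d / 2], [a = 1_E - p] and [b = 1_E - q], the product is [1 + u (p - q) - u^2 a b],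
    where [p - q >= d] and [a b <= 1]. *)
Lemma bet_mul_ge d P n e x : 0 < d <= 1 -> d <= gap P n e ->
  1 + d ^+ 2 / 4 <= bet d P n e true x * bet d P n e false x.
Proof.
move=> d01; rewrite /gap /bet expr0 expr1.
have := fine_forecast_itv (P true) (measurable_cylinder_event (hY:=hY) n e).
have := fine_forecast_itv (P false) (measurable_cylinder_event (hY:=hY) n e).
move: (fine _) (fine _) d01 => p q /andP[d0 d1] /andP[q0 q1] /andP[p0 p1] dpq.
case: (e x); rewrite /= ?mulr1n ?mulr0n.
  have -> : (1 + -1 * (d / 2) * (1 - p)) * (1 + 1 * (d / 2) * (1 - q)) =
    1 + d / 2 * (p - q) - d ^+ 2 / 4 * ((1 - p) * (1 - q)) by field.
  have h : (1 - p) * (1 - q) <= 1 by nra.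
  have : d * d <= d * (p - q) by rewrite ler_pM2l.
  have : d ^+ 2 * ((1 - p) * (1 - q)) <= d ^+ 2.
    by rewrite ler_piMr // sqr_ge0.
  rewrite expr2; lra.
have -> : (1 + -1 * (d / 2) * (0 - p)) * (1 + 1 * (d / 2) * (0 - q)) =
    1 + d / 2 * (p - q) - d ^+ 2 / 4 * (p * q) by field.
have h : p * q <= 1 by nra.
have : d * d <= d * (p - q) by rewrite ler_pM2l.
have : d ^+ 2 * (p * q) <= d ^+ 2 by rewrite ler_piMr // sqr_ge0.
rewrite expr2; lra.
Qed.

Lemma solvent_save s : solvent s -> solvent (save s).
Proof.
move=> s0 b x /=; case: (lerP 2 (asset s b [::])) => /= h.
  2: by rewrite subr0.
by rewrite subr_gt0 (lt_le_trans _ h) // ltr1n.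
Qed.

Lemma solvent_rebalance d P s : 0 < d <= 1 -> solvent s ->
  solvent (rebalance d P s).
Proof.
move=> d01 s0; rewrite /rebalance; case: (horizon s) => [|//].
case: pselect => [dP|_]; last exact: solvent_save.
case: (projT1 _) => n e b x; apply: mulr_gt0; first exact: solvent_save.
exact: bet_gt0.
Qed.

Lemma solvent_shift y s : solvent s -> solvent (shift y s).
Proof. by rewrite /shift; case: (horizon s) => // m s0 b x; exact: s0. Qed.

Lemma saved_rebalance d P s b : (saved s b <= saved (rebalance d P s) b)%N.
Proof.
rewrite /rebalance; case: (horizon s) => [|//].
by case: pselect => [dP|_]; [case: (projT1 _)|]; rewrite /= leq_addr.
Qed.

Lemma saved_shift y s : saved (shift y s) = saved s.
Proof. by rewrite /shift; case: (horizon s). Qed.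

(** The bound concerns the payoffs at settlement, for every outcome: successive forecasts are
    unrelated, so intermediate worths cannot be controlled. *)
Definition product_ge (c : R) s := forall x, size x = horizon s ->
  c <= asset s true x * asset s false x.

Lemma product_ge_shift c y s : product_ge c s -> product_ge c (shift y s).
Proof.
rewrite /product_ge /shift; case hs: (horizon s) => [|m] sc x /= xm.
  by apply: sc; rewrite xm.
by apply: sc; rewrite /= xm.
Qed.

Definition no_saving d P s := forall b, saved (rebalance d P s) b = saved s b.

Lemma no_saving_lt2 d P s b : horizon s = 0%N -> no_saving d P s ->
  asset s b [::] < 2.
Proof.
move=> hs /(_ b); rewrite /rebalance hs ltNge.
case: pselect => [dP|_]; [case: (projT1 _) => n e|] => /=.
all: by case: (2 <= _) => //= /eqP; rewrite addn1 eqn_leq ltnn.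
Qed.

(** Without saving, [save] leaves the cash unchanged, and a new bet multiplies the product by at
    least 1. *)
Lemma product_ge_rebalance d P s c : 0 < d <= 1 -> solvent s ->
  no_saving d P s -> product_ge c s -> product_ge c (rebalance d P s).
Proof.
move=> d01 s0 ns sc; case hs : (horizon s) => [|m]; last first.
  by rewrite /rebalance hs.
have lt2 b : (2 <= asset s b [::]) = false.
  by apply/negbTE; rewrite -ltNge; exact: no_saving_lt2 ns.
have {}sc := sc [::] (esym hs).
rewrite /rebalance hs; case: pselect => [dP|_]; last first.
  by move=> x _ /=; rewrite !lt2 !subr0.
have := projT2 (cid dP); case: (projT1 _) => n e /= ge x _ /=.
rewrite !lt2 !subr0 mulrACA (le_trans sc) // ler_peMr//.
  by rewrite mulr_ge0 // ltW.
apply: le_trans (bet_mul_ge x d01 ge).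
by rewrite lerDl divr_ge0 // sqr_ge0.
Qed.

Lemma product_ge_bet d P s c : 0 < d <= 1 -> solvent s -> horizon s = 0%N ->
  no_saving d P s -> (exists n e, d <= gap P n e) ->
  product_ge c s -> product_ge (c * (1 + d ^+ 2 / 4)) (rebalance d P s).
Proof.
move=> d01 s0 hs ns [n0 [e0 ge0]] sc.
have lt2 b : (2 <= asset s b [::]) = false.
  by apply/negbTE; rewrite -ltNge; exact: no_saving_lt2 ns.
have {}sc := sc [::] (esym hs).
rewrite /rebalance hs; case: pselect => [dP|[]]; last by exists (n0, e0).
have := projT2 (cid dP); case: (projT1 _) => n e /= ge x _ /=.
rewrite !lt2 !subr0 mulrACA.
apply: (@le_trans _ _
  (asset s true [::] * asset s false [::] * (1 + d ^+ 2 / 4))).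
  by rewrite ler_wpM2r // addr_ge0 // divr_ge0 // sqr_ge0.
rewrite ler_wpM2l ?bet_mul_ge // mulr_ge0 // ltW //; exact: s0.
Qed.

End Positions.

(** * Unbounded savings at a single level *)

Lemma infinite_steps_unbounded (u : nat -> nat) j :
    (forall n, (j <= n)%N -> (u n <= u n.+1)%N) ->
    (forall m, exists2 n, (m <= n)%N & (u n < u n.+1)%N) ->
  forall K, exists m, forall n, (m <= n)%N -> (K <= u n)%N.
Proof.
move=> u_le u_lt; elim=> [|K [m Km]]; first by exists 0%N.
have [k mk uk] := u_lt (maxn m j).
exists k.+1 => n /subnK <-; elim: (n - _)%N => [|i IH].
  by apply: leq_ltn_trans uk; apply: Km; lia.
by apply: leq_trans IH _; rewrite addSn; apply: u_le; lia.
Qed.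

Section Run.
Variables (R : realType) (Y : finType) (hY : (0 < #|Y|)%N).
Variables (d : R) (P : nat -> bool -> forecast R hY) (y : nat -> Y).
Variables (s : nat -> position R Y) (j : nat).
Hypothesis d01 : 0 < d <= 1.
Hypothesis s_start : s j = start R Y.
Hypothesis s_step : forall n, (j <= n)%N ->
  s n.+1 = shift (y n) (rebalance d (P n) (s n)).

Lemma run_solvent n : (j <= n)%N -> solvent (s n).
Proof.
move=> /subnK <-; elim: (n - j)%N => [|i IH]; first by rewrite s_start.
by rewrite addSn s_step ?leq_addl//; apply/solvent_shift/solvent_rebalance.
Qed.

Lemma run_saved n b : (j <= n)%N -> (saved (s n) b <= saved (s n.+1) b)%N.
Proof. by move=> jn; rewrite s_step // saved_shift saved_rebalance. Qed.

Section NoSaving.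
Variable m0 : nat.
Hypothesis jm0 : (j <= m0)%N.
Hypothesis s_no_saving : forall n, (m0 <= n)%N -> no_saving d (P n) (s n).

Let run_product_ge n c : (m0 <= n)%N -> product_ge c (s n) ->
  product_ge c (s n.+1).
Proof.
move=> mn sc; have jn := leq_trans jm0 mn.
rewrite s_step //; apply: product_ge_shift; apply: product_ge_rebalance => //.
  exact: run_solvent.
exact: s_no_saving.
Qed.

(** Each round shortens the horizon of a pending bet by one. *)
Lemma run_idle n c : (m0 <= n)%N -> product_ge c (s n) ->
  exists m, [/\ (n <= m)%N, horizon (s m) = 0%N & product_ge c (s m)].
Proof.
move hn : (horizon (s n)) => h; elim: h n hn => [|h IH] n hn mn sc.
  by exists n.
have [||//|m [nm hm scm]] := IH n.+1.
- rewrite s_step ?(leq_trans jm0 mn)//.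
  by rewrite /rebalance hn /shift hn.
- exact: leqW.
- exact: run_product_ge.
by exists m; split => //; exact: ltnW.
Qed.

(** [i] counts the rounds until a known gap. An earlier gap may trigger the bet first, with the same
    factor; otherwise the position stays idle and [i] decreases. *)
Lemma run_idle_bet i n c : (m0 <= n)%N -> horizon (s n) = 0%N ->
    product_ge c (s n) -> (exists k e, d <= gap (P (i + n)%N) k e) ->
  exists2 m, (n <= m)%N & product_ge (c * (1 + d ^+ 2 / 4)) (s m).
Proof.
have bet_now k : (m0 <= k)%N -> horizon (s k) = 0%N -> product_ge c (s k) ->
    (exists l e, d <= gap (P k) l e) ->
    exists2 m, (k <= m)%N & product_ge (c * (1 + d ^+ 2 / 4)) (s m).
  move=> mk hk sc gk; have jk := leq_trans jm0 mk.
  exists k.+1 => //; rewrite s_step //.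
  apply: product_ge_shift; apply: product_ge_bet => //.
    exact: run_solvent.
  exact: s_no_saving.
elim: i n => [|i IH] n mn hn sc gi; first exact: bet_now.
have [[[k e] ge]|ngn] := pselect (exists ke, d <= gap (P n) ke.1 ke.2).
  by apply: bet_now => //; exists k, e.
have [||||m nm scm] := IH n.+1.
- exact: leqW.
- by rewrite s_step ?(leq_trans jm0 mn)// /rebalance hn; case: pselect.
- exact: run_product_ge.
- by rewrite addnS -addSn.
by exists m => //; exact: ltnW.
Qed.

Lemma run_bet n c :
    (forall m, exists2 k, (m <= k)%N & exists i e, d <= gap (P k) i e) ->
    (m0 <= n)%N -> product_ge c (s n) ->
  exists2 m, (n <= m)%N & product_ge (c * (1 + d ^+ 2 / 4)) (s m).
Proof.
move=> gaps mn sc; have [m [nm hm scm]] := run_idle mn sc.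
have [k /subnK km gk] := gaps m; rewrite -km in gk.
have [l ml scl] := run_idle_bet (leq_trans mn nm) hm scm gk.
by exists l => //; exact: leq_trans nm ml.
Qed.

(** With nothing saved, both capitals are below 2 at idle times, so their product is below 4, while
    recurring gaps would push it beyond any bound. *)
Lemma finitely_many_gaps :
  ~ (forall m, exists2 k, (m <= k)%N & exists i e, d <= gap (P k) i e).
Proof.
move=> gaps.
have s0 n : (m0 <= n)%N -> solvent (s n).
  by move=> mn; apply: run_solvent; exact: leq_trans mn.
(* The trivial bound [0] serves to reach a first idle time, where the product is a positive
   constant. *)
have [|n1 [mn1 hn1 _]] := @run_idle m0 0 (leqnn _).
  by move=> x _; rewrite mulr_ge0 // ltW //; exact: s0.
pose c0 := asset (s n1) true [::] * asset (s n1) false [::].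
have c0_gt0 : 0 < c0 by rewrite mulr_gt0 //; exact: s0.
pose r := d ^+ 2 / 4.
have r_gt0 : 0 < r by rewrite divr_gt0 // exprn_gt0 //; case/andP: d01.
(* A linear, Bernoulli-type lower bound on the compound growth suffices for the Archimedean
   argument. *)
have grow k : exists2 n, (m0 <= n)%N & product_ge (c0 * (1 + k%:R * r)) (s n).
  elim: k => [|k [n mn sc]].
    exists n1 => // x; rewrite hn1 => /size0nil ->.
    by rewrite mul0r addr0 mulr1.
  have [m nm scm] := run_bet gaps mn sc.
  exists m => [|x /scm]; first exact: leq_trans nm.
  apply: le_trans; rewrite -/r -mulrA ler_pM2l// -natr1.
  have : 0 <= k%:R * r * r.
    by apply: mulr_ge0 (ltW r_gt0); apply: mulr_ge0 (ltW r_gt0).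
  lra.
(* After [k] bets, with [k] this bound, [c0 * (k * r)] exceeds 4. *)
have [n mn sc] := grow (Num.bound (4 / (c0 * r))).
have [m [nm hm scm]] := run_idle mn sc.
have mm : (m0 <= m)%N := leq_trans mn nm.
have at2 := no_saving_lt2 true hm (s_no_saving mm).
have af2 := no_saving_lt2 false hm (s_no_saving mm).
have a4 : asset (s m) true [::] * asset (s m) false [::] < 4.
  have -> : 4 = 2 * 2 :> R by rewrite -natrM.
  by apply: ltr_pM => //; apply: ltW; exact: s0.
have cr_gt0 : 0 < c0 * r := mulr_gt0 c0_gt0 r_gt0.
have : 4 < c0 * ((Num.bound (4 / (c0 * r)))%:R * r).
  rewrite mulrCA -(ltr_pdivrMr _ _ cr_gt0).
  by apply: archi_boundP; apply: divr_ge0 => //; exact: ltW.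
have := scm [::] (esym hm); rewrite mulrDr mulr1 => le lt.
have : c0 * ((Num.bound (4 / (c0 * r)))%:R * r) < 4.
  by apply: le_lt_trans (le_trans _ le) a4; rewrite lerDr; exact: ltW.
by move=> /(lt_trans lt); rewrite ltxx.
Qed.
End NoSaving.

(** If neither account of savings grew infinitely often, both would be constant from some round on,
    which [finitely_many_gaps] excludes. *)
Lemma run_saved_unbounded :
    (forall m, exists2 n, (m <= n)%N & exists k e, d <= gap (P n) k e) ->
  exists b, forall K, exists m, forall n, (m <= n)%N -> (K <= saved (s n) b)%N.
Proof.
move=> gaps; have [[b sb]|/forallNP ns] := pselect (exists b, forall m,
    exists2 n, (m <= n)%N & (saved (s n) b < saved (s n.+1) b)%N).
  exists b; apply: (@infinite_steps_unbounded _ j) => // n.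
  exact: run_saved.
have {}ns b : exists m, forall n, (m <= n)%N ->
    (saved (s n.+1) b <= saved (s n) b)%N.
  have /existsNP[m mP] := ns b; exists m => n mn.
  by rewrite leqNgt; apply/negP => lt; apply: mP; exists n.
have [mt nst] := ns true; have [mf nsf] := ns false.
exfalso; apply: (@finitely_many_gaps (maxn j (maxn mt mf))) => // [|n mn b].
  exact: leq_maxl.
apply/eqP; rewrite eqn_leq saved_rebalance andbT.
rewrite -(saved_shift (y n)) -s_step; last by lia.
by case: b; [apply: nst|apply: nsf]; lia.
Qed.
End Run.

(** * The mixture over all levels *)

Section Mixture.
Variables (R : realType) (Y : finType) (hY : (0 < #|Y|)%N).

Definition weight j : R := 2^-1 ^+ j.+1.

Definition level j : R := j.+1%:R^-1.

Definition both (p q : forecast R hY) b : forecast R hY := if b then p else q.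

Definition step j (s : position R Y) (r : forecast R hY * forecast R hY * Y) :=
  shift r.2 (rebalance (level j) (both r.1.1 r.1.2) s).

(* Level [j] starts only at round [j], so that finitely many levels are active
   at any time and the mixture is a ticket of finite support. *)
Definition position_at j h : position R Y :=
  foldl (step j) (start R Y) (drop j h).

Definition mixture b : seq (forecast R hY * forecast R hY * Y) ->
    forecast R hY -> forecast R hY -> ticket R Y :=
  fun h p q =>
  let s (j : 'I_(size h).+1) :=
    rebalance (level j) (both p q) (position_at j h) in
  ticket_of (fun x => \sum_(j < (size h).+1)
    at_size (horizon (s j)) (fun x => weight j * asset (s j) b x) x).

Definition merging_strategy : strategy R hY :=
  fun h p q => (mixture true h p q, mixture false h p q).

Lemma weight_gt0 j : 0 < weight j.
Proof. by rewrite exprn_gt0 // invr_gt0. Qed.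

(** The missing [2^-1 ^+ n] is the cash reserved for the levels not yet started. *)
Lemma sum_weight n : \sum_(j < n) weight j = 1 - 2^-1 ^+ n.
Proof.
elim: n => [|n IH]; first by rewrite big_ord0 expr0 subrr.
by rewrite big_ord_recr /= IH /weight exprS; lra.
Qed.

Lemma level_itv j : 0 < level j <= 1.
Proof. by rewrite invr_gt0 ltr0n /= invf_le1 ?ltr0n // ler1n. Qed.

Section Play.
Variables (P Q : nat -> forecast R hY) (y : nat -> Y).

Let history n := mkseq (fun k => (P k, Q k, y k)) n.
Let s j n := position_at j (history n).

Lemma position_at_start j n : (n <= j)%N -> s j n = start R Y.
Proof. by move=> nj; rewrite /s /position_at drop_oversize // size_mkseq. Qed.

Lemma position_atS j n : (j <= n)%N -> s j n.+1 =
  shift (y n) (rebalance (level j) (both (P n) (Q n)) (s j n)).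
Proof.
move=> jn; rewrite /s /position_at /history mkseqS drop_rcons ?size_mkseq//.
by rewrite foldl_rcons.
Qed.

Let K b := capital (fun n => both (P n) (Q n) b)
  (fun n => mixture b (history n) (P n) (Q n)) y.

(** Rebalancing is free, so the increment of the capital is the weighted sum of the changes in worth
    caused by [shift] and the new forecasts. *)
Lemma capital_mixture b n : K b n =
  1 + \sum_(j < n) weight j * (worth (both (P n) (Q n)) b (s j n) - 1).
Proof.
elim: n => [|n IH]; first by rewrite big_ord0 addr0.
rewrite /K /= -/(K b n) IH /mixture.
rewrite sum_ticket sum_ticket_cons size_mkseq -addrA -sumrB.
set D := \sum_(_ < _) (_ - _).
have -> : D = \sum_(j < n.+1) weight j *
   (worth (both (P n.+1) (Q n.+1)) b (s j n.+1) -
    worth (both (P n) (Q n)) b (s j n)).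
  apply: eq_bigr => j _.
  rewrite position_atS -1?ltnS //.
  rewrite -(worth_rebalance (level j) (both (P n) (Q n)) b (s j n)) worth_shift.
  by case: (horizon _) => [|m]; rewrite ?subr0 ?mulr0 // mulrBr -!priceZ.
rewrite -addrA; congr (1 + _).
rewrite [in RHS](eq_bigr (fun j : 'I_n.+1 =>
  weight j * (worth (both (P n) (Q n)) b (s j n) - 1) +
  weight j * (worth (both (P n.+1) (Q n.+1)) b (s j n.+1)
     - worth (both (P n) (Q n)) b (s j n)))); last first.
  by move=> j _; ring.
(* Level [n] enters with worth 1, so its term, absent from the induction hypothesis, is zero. *)
rewrite big_split /= [in RHS]big_ord_recr /=.
by rewrite position_at_start // worth_start subrr mulr0 addr0.
Qed.

Lemma worth_ge_saved b j n :
  (saved (s j n) b)%:R <= worth (both (P n) (Q n)) b (s j n).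
Proof.
rewrite lerDl price_ge0 // => x.
case: (leqP n j) => jn; first by rewrite position_at_start.
apply: ltW; apply: (@run_solvent _ _ _ (level j)
  (fun n => both (P n) (Q n)) y (s j) j).
- exact: level_itv.
- exact: position_at_start.
- by move=> m; exact: position_atS.
- exact: ltnW.
Qed.

(** The capital is [2^-1 ^+ n] plus the weighted worths, all non-negative; only level [j] is
    kept. *)
Lemma capital_mixture_ge b j n : (j < n)%N ->
  weight j * (saved (s j n) b)%:R <= K b n.
Proof.
move=> jn; rewrite capital_mixture.
pose W (i : 'I_n) := weight i * worth (both (P n) (Q n)) b (s i n).
have W0 i : 0 <= W i.
  rewrite mulr_ge0 ?(ltW (weight_gt0 _))//.
  by rewrite (le_trans _ (worth_ge_saved _ _ _)).
rewrite (eq_bigr (fun i : 'I_n => W i - weight i)); last first.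
  by move=> i _; rewrite mulrBr mulr1.
rewrite sumrB sum_weight (bigD1 (Ordinal jn)) //=.
have : 0 <= \sum_(i < n | i != Ordinal jn) W i by exact: sumr_ge0.
have : weight j * (saved (s j n) b)%:R <= W (Ordinal jn).
  by rewrite ler_pM2l ?weight_gt0// worth_ge_saved.
have : 0 <= 2^-1 ^+ n :> R by rewrite exprn_ge0 // invr_ge0.
lra.
Qed.

Lemma capital_mixture_ge0 b n : 0 <= K b n.
Proof.
case: n => [|n]; first by rewrite /K /= ler01.
apply: le_trans (capital_mixture_ge b (ltn0Sn n)).
by rewrite mulr_ge0 // ltW // weight_gt0.
Qed.

(** The savings of level [j] against one forecaster grow without bound, and they enter the capital
    with a fixed positive weight. *)
Lemma capital_mixture_cvgy j :
    (forall m, exists2 n, (m <= n)%N &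
      exists k e, level j <= gap (both (P n) (Q n)) k e) ->
  exists b, K b n @[n --> \oo] --> +oo.
Proof.
move=> gaps.
have [b sb] := @run_saved_unbounded _ _ _ (level j)
  (fun n => both (P n) (Q n)) y (s j) j
  (level_itv j) (position_at_start (leqnn j)) (@position_atS j) gaps.
exists b; apply/cvgryPge => A.
have [m mP] := sb (Num.bound (`|A| / weight j)).
exists (maxn m j.+1) => // n /=; rewrite geq_max => /andP[/mP sn jn].
apply: le_trans (capital_mixture_ge b jn).
rewrite mulrC -ler_pdivrMr ?weight_gt0//.
apply: (@le_trans _ _ (`|A| / weight j)).
  by rewrite ler_wpM2r ?ler_norm// invr_ge0 ltW ?weight_gt0.
apply: (@le_trans _ _ (Num.bound (`|A| / weight j))%:R).
  2: by rewrite ler_nat.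
by apply/ltW/archi_boundP; rewrite divr_ge0 // ltW ?weight_gt0.
Qed.

(** By contraposition: once all gaps stay below [level j], the distance is at most [2 * level j],
    which is arbitrarily small. *)
Lemma level_gaps : ~ (tv_dist (P n) (Q n) @[n --> \oo] --> (0 : R)) ->
  exists j, forall m, exists2 n, (m <= n)%N &
    exists k e, level j <= gap (both (P n) (Q n)) k e.
Proof.
move=> ncvg; apply: contra_notP ncvg => /forallNP ngaps.
apply/cvgrPdist_le => /= e e0.
have [j je] : exists j, 2 * level j <= e.
  exists (Num.bound (2 / e)).
  rewrite /level ler_pdivrMr // mulrC -ler_pdivrMr //.
  apply: (@le_trans _ _ (Num.bound (2 / e))%:R); last by rewrite ler_nat.
  by apply/ltW/archi_boundP; rewrite divr_ge0 // ltW.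
have /existsNP[m mP] := ngaps j.
exists m => // n /= mn; rewrite sub0r normrN ger0_norm ?tv_dist_ge0//.
apply: le_trans je; apply: tv_dist_le => k a; rewrite leNgt; apply/negP => lt.
by apply: mP; exists n => //; exists k, a; exact: ltW.
Qed.

End Play.
End Mixture.

Theorem theorem4 (R : realType) (Y : finType) (hY : (0 < #|Y|)%N) :
  exists S : strategy R hY,
    forall (PI PII : nat -> forecast R hY) (y : nat -> Y),
      (forall n : nat,
         0 <= capital_I S PI PII y n /\ 0 <= capital_II S PI PII y n) /\
      [\/ tv_dist (PI n) (PII n) @[n --> \oo] --> (0 : R),
          capital_I S PI PII y n @[n --> \oo] --> +oo |
          capital_II S PI PII y n @[n --> \oo] --> +oo].
Proof.
exists (@merging_strategy R Y hY) => PI PII y; split.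
  by move=> n; split; [exact: (capital_mixture_ge0 _ _ _ true)|
                       exact: (capital_mixture_ge0 _ _ _ false)].
have [cvg0|/level_gaps[j /capital_mixture_cvgy-/(_ y)[[] Ky]]] :=
  pselect (tv_dist (PI n) (PII n) @[n --> \oo] --> (0 : R)).
- by apply: Or31.
- by apply: Or32.
- by apply: Or33.
Qed.
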